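(* Let $k\ge 1$ and $n\ge 1$ be integers and let $\lambda\in[0,1]$. Then $G_{k,n}(\lambda,p)$ does not depend on $p=(p_1,\dots,p_k)\in\Delta^{k-1}$; that is, $G_{k,n}(\lambda,p)=G_{k,n}(\lambda,q)$ for all $p,q\in\Delta^{k-1}$.
   Context: $\Delta^{k-1}=\{p\in\mathbb{R}^k: p_i\ge 0,\ \sum_{i=1}^k p_i=1\}$. For integers $k\ge 1$, $n\ge 1$, $p\in\Delta^{k-1}$, $\lambda\in[0,1]$, $$G_{k,n}(\lambda,p):=\sum_{X_1,\dots,X_k}\binom{n}{X_1,\dots,X_k}\prod_{i=1}^k\left[\lambda X_i/n+(1-\lambda)p_i\right]^{X_i},$$ where the sum is over non-negative integers $X_1,\dots,X_k$ with $X_1+\dots+X_k=n$, and $0^0=1$. *)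

(* Defs.v *)
(* MathComp world; the real numbers are an arbitrary [R : realType]. *)
From mathcomp Require Import all_boot all_order all_algebra.
From mathcomp Require Import reals.

Set Implicit Arguments.
Unset Strict Implicit.
Unset Printing Implicit Defensive.

Import Order.TTheory GRing.Theory Num.Theory.
Local Open Scope ring_scope.

(* The simplex Delta^(k-1), a subset of R^k: the argument [k] is the number of
   coordinates, not the dimension of the simplex. *)
Definition in_simplex (R : realType) (k : nat) (p : 'rV[R]_k) : Prop :=
  (forall i : 'I_k, 0 <= p 0 i) /\ \sum_(i < k) p 0 i = 1.

Definition multinomial (R : realType) (k n : nat) (X : 'I_k -> nat) : R :=
  n`!%:R / \prod_(i < k) (X i)`!%:R.

(* Non-negative integers X_1, ..., X_k summing to n are all at most n, so the
   tuples are indexed by the finite type of functions 'I_k -> {0, ..., n}.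
   The convention 0 ^ 0 = 1 is that of [^+]. *)
Definition G (R : realType) (k n : nat) (lambda : R) (p : 'rV[R]_k) : R :=
  \sum_(X : {ffun 'I_k -> 'I_n.+1} | ((\sum_(i < k) X i)%N == n))
     multinomial R n (fun i => X i : nat) *
     \prod_(i < k) (lambda * (X i)%:R / n%:R + (1 - lambda) * p 0 i) ^+ X i.

(* Main.v *)
Require Import Defs.
From mathcomp Require Import all_boot all_order all_algebra.
From mathcomp Require Import reals.
From mathcomp Require Import ring.

Set Implicit Arguments.
Unset Strict Implicit.
Unset Printing Implicit Defensive.

Import Order.TTheory GRing.Theory Num.Theory.
Local Open Scope ring_scope.

(** Put [a = lambda / n] and [b i = (1 - lambda) * p i]. Then [G n lambda p] is
    [n`!] times
<<
      S_n(b) = \sum_(X_1 + ... + X_k = n) \prod_i (a X_i + b_i)^(X_i) / X_i!,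
>>
    and [\sum_i b i = 1 - lambda] whatever the point [p] of the simplex. So it
    is enough that [S_n(b)] depends on [b] only through the sum of its
    coordinates, a form of Abel's generalization of the binomial theorem.

    This goes by induction on [n]. Differentiating the factor of index [i]
    lowers its exponent by one, and
<<
      a (x + 1) + b_i = a x + (b_i + a),
>>
    so the partial derivative of [S_(n+1)] along [b_i] is [S_n(b + a e_i)]
    ([deriv_abel_poly]). The points [b + a e_i] have the same coordinate sum for
    all [i], so by induction all partial derivatives of [S_(n+1)] coincide. The
    derivative of [S_(n+1)] in a direction [c] is then a multiple of
    [\sum_i c i], and vanishes when [c] joins two points of equal coordinate sum:
    [S_(n+1)] takes the same value at both ([abel_sum_invariant]).

    Only formal derivatives are needed: [t |-> S_(n+1)(b + t c)] is a polynomial,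
    its derivative is zero because it vanishes at all points of an infinite
    field, and in characteristic zero it is then constant. *)

Section PolynomialsInCharacteristicZero.
Variable F : numFieldType.
Implicit Type p : {poly F}.

Lemma poly_eq0_of_roots p : (forall t, p.[t] = 0) -> p = 0.
Proof.
move=> p0; apply/eqP; apply/negPn/negP => nz_p.
pose s : seq F := [seq i%:R | i <- iota 0 (size p)].
have rs : all (root p) s by apply/allP => x _; rewrite rootE p0.
have us : uniq s.
  by rewrite map_inj_uniq ?iota_uniq //; apply: mulrIn; rewrite oner_eq0.
by have := max_poly_roots nz_p rs us; rewrite size_map size_iota ltnn.
Qed.

Lemma horner_of_deriv_eq0 p x y : p^`() = 0 -> p.[x] = p.[y].
Proof.
move=> dp0; suff /size1_polyC -> : (size p <= 1)%N by rewrite !hornerC.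
apply/leq_sizeP => -[|i] // _; apply/eqP.
by have /eqP := coef_deriv p i; rewrite dp0 coef0 eq_sym mulrn_eq0.
Qed.

Lemma deriv_prod (I : finType) (f : I -> {poly F}) :
  (\prod_i f i)^`() = \sum_i (f i)^`() * \prod_(j | j != i) f j.
Proof.
elim: (index_enum I) (index_enum_uniq I) => [|x s IHs] /=.
  by rewrite !big_nil derivC.
case/andP=> xs /IHs {}IHs; rewrite !big_cons eqxx derivM IHs mulr_sumr /=.
congr (_ * _ + _).
  rewrite big_seq [in RHS]big_seq_cond; apply: eq_bigl => j.
  by have [js|] := boolP (j \in s) => //=; rewrite (memPn xs).
rewrite big_seq [in RHS]big_seq; apply: eq_bigr => i si.
by rewrite big_cons eq_sym (memPn xs) // mulrCA.
Qed.

End PolynomialsInCharacteristicZero.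

Section AbelSums.
Variables (F : numFieldType) (I : finType) (N : nat) (a : F).
Implicit Types (x m : nat) (b c : I -> F) (X : {ffun I -> 'I_N.+1}).

Definition abel_term x (u : F) : F := (a * x%:R + u) ^+ x / x`!%:R.

(** The bound [N] on the exponents is kept apart from their sum [m], so that all
    the sums met in an induction on [m] have the same index type; it excludes
    no exponent as long as [m <= N]. *)
Definition abel_sum m b : F :=
  \sum_(X : {ffun I -> 'I_N.+1} | (\sum_i X i)%N == m) \prod_i abel_term (X i) (b i).

(** [abel_term] and [abel_sum] on the line [t |-> b + t c], as polynomials
    in [t]. *)
Definition abel_term_poly x (u v : F) : {poly F} :=
  x`!%:R^-1 *: ((a * x%:R + u)%:P + v *: 'X) ^+ x.

Definition abel_poly m b c : {poly F} :=
  \sum_(X : {ffun I -> 'I_N.+1} | (\sum_i X i)%N == m) \prod_i abel_term_poly (X i) (b i) (c i).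

Lemma horner_abel_term_poly x u v t :
  (abel_term_poly x u v).[t] = abel_term x (u + v * t).
Proof. by rewrite /abel_term_poly /abel_term addrA !hornerE mulrC. Qed.

Lemma horner_abel_poly m b c t :
  (abel_poly m b c).[t] = abel_sum m (fun i => b i + c i * t).
Proof.
rewrite horner_sum; apply: eq_bigr => X _; rewrite horner_prod.
by apply: eq_bigr => i _; rewrite horner_abel_term_poly.
Qed.

Lemma deriv_abel_term_poly0 u v : (abel_term_poly 0 u v)^`() = 0.
Proof. by rewrite /abel_term_poly expr0 derivZ derivE scaler0. Qed.

(** Abel's terms form a sequence closed under differentiation up to a shift of
    the parameter, as the powers in the binomial theorem do without shift. *)
Lemma deriv_abel_term_polyS x u v :
  (abel_term_poly x.+1 u v)^`() = v *: abel_term_poly x (u + a) v.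
Proof.
rewrite /abel_term_poly derivZ deriv_exp /= derivD derivC derivZ derivX add0r.
have -> : a * x.+1%:R + u = a * x%:R + (u + a) by rewrite -natr1; ring.
rewrite -scalerAl mul1r -scaler_nat !scalerA factS natrM; congr (_ *: _).
by field; rewrite nat1r !pnatr_eq0 -lt0n fact_gt0.
Qed.

Definition shift_at (i : I) b : I -> F := fun j => if j == i then b j + a else b j.

Lemma sum_shift_at i b : \sum_j shift_at i b j = \sum_j b j + a.
Proof.
rewrite (bigD1 i) //= [in RHS](bigD1 i) //= /shift_at eqxx addrAC.
by congr (_ + _ + _); apply: eq_bigr => j /negPf ->.
Qed.

Definition incr_at (i : I) X : {ffun I -> 'I_N.+1} :=
  [ffun j => if j == i then inord (X j).+1 else X j].

Definition decr_at (i : I) X : {ffun I -> 'I_N.+1} :=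
  [ffun j => if j == i then inord (X j).-1 else X j].

Lemma decr_atK i X : (0 < X i)%N -> incr_at i (decr_at i X) = X.
Proof.
move=> Xi; apply/ffunP => j; rewrite !ffunE; case: eqP => // ->.
have ltX : ((X i).-1 < N.+1)%N by rewrite (leq_ltn_trans (leq_pred _)).
by rewrite (inordK ltX) prednK // inord_val.
Qed.

Lemma leq_coord m X i : (\sum_j X j)%N = m -> (X i <= m)%N.
Proof. by move=> <-; rewrite (bigD1 i) //= leq_addr. Qed.

(** This is the condition under which [incr_at i] reindexes a sum over the [X] of
    sum [m.+1] with [X i] positive into a sum over the [X] of sum [m]. *)
Lemma incr_atP m i X : (m < N)%N ->
  (((\sum_j incr_at i X j)%N == m.+1) && (0 < incr_at i X i)%N
     && (decr_at i (incr_at i X) == X))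
  = ((\sum_j X j)%N == m).
Proof.
move=> ltmN; have [ltXN|] := ltnP (X i) N.
  have Ei : incr_at i X i = (X i).+1 :> nat by rewrite ffunE eqxx inordK.
  have -> : (\sum_j incr_at i X j)%N = (\sum_j X j).+1.
    rewrite (bigD1 i) //= Ei [in RHS](bigD1 i) //= addSn; congr (_ + _).+1.
    by apply: eq_bigr => j /negPf ji; rewrite ffunE ji.
  rewrite eqSS Ei; suff -> : decr_at i (incr_at i X) = X by rewrite eqxx !andbT.
  apply/ffunP => j; rewrite ffunE; case: eqP => [->|/eqP/negPf ji].
    by apply: val_inj; rewrite /= Ei /= inordK.
  by rewrite ffunE ji.
(* At [X i = N] the successor overflows to [0], and neither side holds. *)
move=> leNX; have EX : X i = N :> nat.
  by apply/eqP; rewrite eqn_leq leNX -ltnS ltn_ord.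
have -> : incr_at i X i = 0%N :> nat.
  by rewrite ffunE eqxx EX /inord /insubd insubF //= ltnn.
rewrite andbF; apply/esym/negP => /eqP /(leq_coord i).
by rewrite EX leqNgt ltmN.
Qed.

(** By the Leibniz rule the factor of index [i] alone is differentiated. This
    kills the terms with [X i = 0]; in the others it lowers [X i] by one and
    shifts [b i] by [a]. *)
Lemma deriv_abel_poly m b c : (m < N)%N ->
  (abel_poly m.+1 b c)^`() = \sum_i c i *: abel_poly m (shift_at i b) c.
Proof.
move=> ltmN; rewrite /abel_poly raddf_sum /=.
under eq_bigr => X _ do rewrite deriv_prod.
rewrite exchange_big /=; apply: eq_bigr => i _.
rewrite scaler_sumr.
rewrite (bigID (fun X => 0 < X i)%N) /= [X in _ + X]big1 ?addr0; last first.
  by move=> X /andP[_]; rewrite -eqn0Ngt => /eqP ->;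
     rewrite deriv_abel_term_poly0 mul0r.
rewrite (reindex_onto (incr_at i) (decr_at i)) /=; last first.
  by move=> X /andP[_ /decr_atK].
apply: eq_big => [X|X]; rewrite incr_atP // => /eqP /(leq_coord i) leXm.
rewrite [in RHS](bigD1 i) //= /shift_at eqxx scalerAl ffunE eqxx.
rewrite inordK; last by rewrite ltnS; apply: leq_ltn_trans ltmN.
rewrite deriv_abel_term_polyS; congr (_ * _).
by apply: eq_bigr => j /negPf ji; rewrite ffunE ji.
Qed.

(** The polynomial joining [b] to [b'] has derivative zero: the induction
    hypothesis makes the coefficients of the [c i] in [deriv_abel_poly] equal,
    and the [c i] add up to zero. *)
Lemma abel_sum_invariant m b b' : (m <= N)%N ->
  \sum_i b i = \sum_i b' i -> abel_sum m b = abel_sum m b'.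
Proof.
elim: m b b' => [|m IHm] b b' lemN sumbb'.
  apply: eq_bigr => X; rewrite sum_nat_eq0 => /forallP /= X0.
  by apply: eq_bigr => i _; have /eqP -> := X0 i; rewrite /abel_term !expr0.
pose c i := b' i - b i.
have sumc : \sum_i c i = 0 by rewrite sumrB sumbb' subrr.
have -> : abel_sum m.+1 b = (abel_poly m.+1 b c).[0].
  rewrite horner_abel_poly; apply: eq_bigr => X _.
  by apply: eq_bigr => i _; rewrite mulr0 addr0.
have -> : abel_sum m.+1 b' = (abel_poly m.+1 b c).[1].
  rewrite horner_abel_poly; apply: eq_bigr => X _.
  by apply: eq_bigr => i _; rewrite mulr1 /c addrC subrK.
apply: horner_of_deriv_eq0; apply: poly_eq0_of_roots => t.
rewrite deriv_abel_poly // horner_sum.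
(* The common coordinate sum of the shifted points is [\sum_j b j + a], so they
   can all be exchanged for the one with a reference coordinate shifted. *)
have [i0 _|I0] := pickP I; last by rewrite big_pred0.
pose v := (abel_poly m (shift_at i0 b) c).[t].
transitivity (\sum_i c i * v); last by rewrite -mulr_suml sumc mul0r.
apply: eq_bigr => i _; rewrite hornerZ /v !horner_abel_poly; congr (_ * _).
by apply: IHm; [exact: ltnW | rewrite !big_split /= !sum_shift_at].
Qed.

End AbelSums.

Lemma G_abel_sum (R : realType) (k n : nat) (lambda : R) (p : 'rV[R]_k) :
  G n lambda p =
  n`!%:R * abel_sum n (lambda / n%:R) n (fun i => (1 - lambda) * p 0 i).
Proof.
rewrite /G /abel_sum mulr_sumr; apply: eq_bigr => X _.
rewrite /multinomial -mulrA; congr (_ * _).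
rewrite -prodfV -big_split /=; apply: eq_bigr => i _.
by rewrite /abel_term mulrC (mulrAC lambda).
Qed.

Theorem proposition1 (R : realType) (k n : nat) (lambda : R)
    (hk : (1 <= k)%N) (hn : (1 <= n)%N) (hlambda : 0 <= lambda <= 1) :
  forall p q : 'rV[R]_k, in_simplex p -> in_simplex q ->
    G n lambda p = G n lambda q.
Proof.
move=> p q [_ sump] [_ sumq]; rewrite !G_abel_sum; congr (_ * _).
by apply: abel_sum_invariant; rewrite // -!mulr_sumr sump sumq.
Qed.
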